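(* Let $1\le k\le n$ and let $\lambda$ be an $(n,k)$-bipartition. Then the subspaces $I_\lambda^{(k)\trianglelefteq}$ and $I_\lambda^{(k)\triangleleft}$ of $\mathbf{H}'_{(1^{k-1},n-k+1)}$ are $S_n$-invariant; consequently $S_n$ acts on the quotient $R_\lambda^{(k)}=I_\lambda^{(k)\trianglelefteq}/I_\lambda^{(k)\triangleleft}$.
   Context: Let $\mathbf{Q}[\bar x,\bar y]=\mathbf{Q}[x_1,\dots,x_n,y_1,\dots,y_n]$ with $S_n$ acting by $\sigma(x_i)=x_{\sigma(i)}$, $\sigma(y_i)=y_{\sigma(i)}$. For the hook shape $\mu=(1^{k-1},n-k+1)$ let $\Delta_\mu$ be the determinant of the $n\times n$ matrix whose $i$-th row is $(1,y_i,\dots,y_i^{n-k},x_i,\dots,x_i^{k-1})$. Let $\mathbf{H}_\mu$ be the $\mathbf{Q}$-span of all partial derivatives (of all orders, including order $0$) of $\Delta_\mu$. Let $\langle f,g\rangle$ be the constant term of $f(\partial_{x_1},\dots,\partial_{x_n};\partial_{y_1},\dots,\partial_{y_n})\,g(\bar x;\bar y)$, let $J_\mu=\mathbf{H}_\mu^\perp$ with respect to $\langle\ ,\ \rangle$ (an $S_n$-invariant ideal), and $\mathbf{H}'_\mu=\mathbf{Q}[\bar x,\bar y]/J_\mu$. For $\pi\in S_n$ let $\mathrm{Des}(\pi)=\{1\le i\le n-1:\pi(i)>\pi(i+1)\}$; let $d_i=|\mathrm{Des}(\pi)\cap\{i,\dots,k-1\}|$ for $1\le i<k$, $d_k=0$,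 $d_i=|\mathrm{Des}(\pi)\cap\{k,\dots,i-1\}|$ for $k<i\le n$, and $a_\pi^{(k)}=\prod_{i=1}^{k-1}x_{\pi(i)}^{d_i}\prod_{i=k+1}^{n}y_{\pi(i)}^{d_i}$. Its exponent bipartition is $\lambda(a_\pi^{(k)})=((d_1,\dots,d_{k-1},0),(d_n,d_{n-1},\dots,d_{k+1},0))$. An $(n,k)$-bipartition is a pair $\lambda=(\mu,\nu)$ of partitions $\mu=(\mu_1\ge\cdots\ge\mu_{k-1}\ge\mu_k=0)$, $\nu=(\nu_1\ge\cdots\ge\nu_{n-k}\ge\nu_{n-k+1}=0)$ with $\mu_i-\mu_{i+1}\in\{0,1\}$ for $1\le i\le k-1$ and $\nu_i-\nu_{i+1}\in\{0,1\}$ for $1\le i\le n-k$. For bipartitions, $(\mu^1,\nu^1)\trianglelefteq(\mu^2,\nu^2)$ means $\mu^1\trianglelefteq\mu^2$ and $\nu^1\trianglelefteq\nu^2$ in dominance order of partitions (of equal size); $\triangleleft$ means $\trianglelefteq$ and not equal. Put $I_\lambda^{(k)\trianglelefteq}=\mathrm{span}_{\mathbf{Q}}\{a_\pi^{(k)}+J_{(1^{k-1},n-k+1)}:\pi\in S_n,\ \lambda(a_\pi^{(k)})\trianglelefteq\lambda\}$ and $I_\lambda^{(k)\triangleleft}=\mathrm{span}_{\mathbf{Q}}\{a_\pi^{(k)}+J_{(1^{k-1},n-k+1)}:\pi\in S_n,\ \lambda(a_\pi^{(k)})\triangleleft\lambda\}$. *)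

(* Defs.v *)
From HB Require Import structures.
From mathcomp Require Import all_boot all_order all_algebra all_fingroup.
From mathcomp Require Import generic_quotient ring_quotient bigenough.
From mathcomp Require Import ssrcomplements mpoly boolp.

Set Implicit Arguments.
Unset Strict Implicit.
Unset Printing Implicit Defensive.

Import GRing.Theory BigEnough.
Local Open Scope ring_scope.

Section Span.
Variables (K : nzRingType) (V : lmodType K).

Definition lspan (S : V -> Prop) : {pred V} :=
  fun u => `[< exists (m : nat) (c : 'I_m -> K) (v : 'I_m -> V),
                 (forall i, S (v i)) /\ u = \sum_i c i *: v i >].

Lemma lspanP (S : V -> Prop) (u : V) :
  reflect (exists (m : nat) (c : 'I_m -> K) (v : 'I_m -> V),
             (forall i, S (v i)) /\ u = \sum_i c i *: v i)
          (u \in lspan S).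
Proof. exact: asboolP. Qed.

Fact lspan_submod_closed (S : V -> Prop) : submod_closed (lspan S).
Proof.
split.
  apply/lspanP; exists 0, (fun=> 0), (fun=> 0).
  by split; [case | rewrite big_ord0].
move=> a u w /lspanP[m [c [v [Sv ->]]]] /lspanP[p [d [x [Sx ->]]]].
apply/lspanP; exists (m + p)%N.
exists (fun i => match split i with inl j => a * c j | inr j => d j end).
exists (fun i => match split i with inl j => v j | inr j => x j end).
split; first by move=> i; case: split.
rewrite big_split_ord scaler_sumr /=; congr (_ + _); apply: eq_bigr => i _.
  by rewrite (unsplitK (inl i)) scalerA.
by rewrite (unsplitK (inr i)).
Qed.
HB.instance Definition _ (S : V -> Prop) :=
  GRing.isSubmodClosed.Build K V (lspan S) (lspan_submod_closed S).

End Span.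

Section SubQuotient.
Variables (K : nzRingType) (V : lmodType K) (W : submodClosed V).

Record lsub := LSub { lsub_val :> V; lsub_valP : lsub_val \in W }.
HB.instance Definition _ := [isSub for lsub_val].
HB.instance Definition _ := [Choice of lsub by <:].
HB.instance Definition _ := [SubChoice_isSubLmodule of lsub by <:].

(** [submodClosed] does not carry the closure under opposites that the
    quotient of an additive group requires. *)
Definition zmod_of : {pred V} := fun v => v \in W.
Fact zmod_of_closed : zmod_closed zmod_of.
Proof.
split=> [|u v Wu Wv]; rewrite unfold_in ?rpred0 //.
by rewrite rpredD // -scaleN1r rpredZ.
Qed.
HB.instance Definition _ := GRing.isZmodClosed.Build V zmod_of zmod_of_closed.

Definition lquot := @Quotient.quot V zmod_of.
HB.instance Definition _ := GRing.Zmodule.on lquot.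

Definition lclass (v : V) : lquot := (\pi_(@Quotient.quot V zmod_of) v)%qT.

Lemma lclassP (u v : V) : lclass u = lclass v <-> u - v \in W.
Proof.
by rewrite -[u - v \in W]/(u - v \in zmod_of) Quotient.idealrBE; split=> /eqP.
Qed.

Lemma lclassD : {morph lclass : u v / u + v}.
Proof. exact: raddfD. Qed.

Definition lrepr (x : lquot) : V := repr x.

Lemma lreprK : cancel lrepr lclass.
Proof. exact: reprK. Qed.

Definition lquot_scale (a : K) (x : lquot) : lquot := lclass (a *: lrepr x).

Lemma lclassZ a v : lclass (a *: v) = lquot_scale a (lclass v).
Proof.
apply/lclassP; rewrite -scalerBr rpredZ //; apply/lclassP.
by rewrite lreprK.
Qed.

Fact lquot_scaleA a b x : lquot_scale a (lquot_scale b x) = lquot_scale (a * b) x.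
Proof. by rewrite -[x]lreprK -!lclassZ scalerA. Qed.
Fact lquot_scale1 : left_id 1 lquot_scale.
Proof. by move=> x; rewrite -[x]lreprK -!lclassZ scale1r. Qed.
Fact lquot_scaleDr : right_distributive lquot_scale +%R.
Proof.
move=> a x y; rewrite -[x]lreprK -[y]lreprK -lclassD -!lclassZ -lclassD.
by rewrite scalerDr.
Qed.
Fact lquot_scaleDl x : {morph lquot_scale^~ x : a b / a + b}.
Proof.
by move=> a b; rewrite -[x]lreprK -!lclassZ -lclassD scalerDl.
Qed.
HB.instance Definition _ := GRing.Zmodule_isLmodule.Build K lquot
  lquot_scaleA lquot_scale1 lquot_scaleDr lquot_scaleDl.

Fact lclass_is_linear : linear lclass.
Proof. by move=> a u v; rewrite lclassD lclassZ. Qed.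
HB.instance Definition _ :=
  GRing.isLinear.Build K V lquot _ lclass lclass_is_linear.

End SubQuotient.

Section RelativeQuotient.
Variables (K : nzRingType) (V : lmodType K) (U W : submodClosed V).

Definition lsub_in : {pred lsub U} := fun u => val u \in W.

Fact lsub_in_submod_closed : submod_closed lsub_in.
Proof.
by split=> [|a u v Wu Wv]; rewrite /lsub_in unfold_in /= ?rpred0 // rpredD ?rpredZ.
Qed.
HB.instance Definition _ :=
  GRing.isSubmodClosed.Build K (lsub U) lsub_in lsub_in_submod_closed.

(** [U / (U :&: W)], that is [U / W] when [W] is contained in [U]. *)
Definition subquot := lquot lsub_in.

End RelativeQuotient.

Section Pairing.
Variables (N : nat).
Implicit Types f g : {mpoly rat[N]}.

Definition diffop f g : {mpoly rat[N]} := \sum_(m <- msupp f) f@_m *: g^`M[m].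

Definition pairing f g : rat := (diffop f g)@_0.

Lemma pairingE f g : pairing f g =
  \sum_(m <- msupp f) f@_m * g@_m *+ \prod_(i < N) (m i)`!.
Proof.
rewrite /pairing /diffop raddf_sum; apply: eq_bigr => m _ /=.
rewrite mcoeffZ mcoeff_mderivm addm0 mulrnAr; congr (_ *+ _).
by apply: eq_bigr => i _; rewrite ffactnn.
Qed.

Lemma pairing_small d f g : (msize f <= d)%N -> pairing f g =
  \sum_(m : 'X_{1..N < d}) f@_m * g@_m *+ \prod_(i < N) (m i)`!.
Proof.
move=> led; rewrite pairingE (big_mksub 'X_{1..N < d}) //=.
- rewrite big_rmcond //= => m /memN_msupp_eq0 ->.
  by rewrite mul0r mul0rn.
- exact: msupp_uniq.
- by move=> m /msize_mdeg_lt /leq_trans; apply.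
Qed.

Fact pairing_linear g a f1 f2 :
  pairing (a *: f1 + f2) g = a * pairing f1 g + pairing f2 g.
Proof.
pose_big_enough d; first rewrite !(@pairing_small d) //.
  rewrite mulr_sumr -big_split /=; apply: eq_bigr => m _.
  by rewrite mcoeffD mcoeffZ mulrDl mulrnDl mulrnAr !mulrA.
by close.
Qed.

Definition orthogonal_to (S : {pred {mpoly rat[N]}}) : {pred {mpoly rat[N]}} :=
  fun f => `[< forall g, g \in S -> pairing f g = 0 >].

Lemma orthogonal_toP (S : {pred {mpoly rat[N]}}) f :
  reflect (forall g, g \in S -> pairing f g = 0) (f \in orthogonal_to S).
Proof. exact: asboolP. Qed.

Fact orthogonal_to_submod_closed S : submod_closed (orthogonal_to S).
Proof.
split=> [|a f1 f2 /orthogonal_toP h1 /orthogonal_toP h2].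
  by apply/orthogonal_toP => g _; rewrite pairingE msupp0 big_nil.
by apply/orthogonal_toP => g Sg; rewrite pairing_linear h1 ?h2 // mulr0 addr0.
Qed.
HB.instance Definition _ S :=
  GRing.isSubmodClosed.Build rat {mpoly rat[N]} (orthogonal_to S)
    (orthogonal_to_submod_closed S).

Lemma pairing_sym (s : 'S_N) f g : pairing (msym s f) (msym s g) = pairing f g.
Proof.
elim/mpolyind: f => [|c m f _ _ IH].
  by rewrite raddf0 !pairingE msupp0 !big_nil.
rewrite raddfD /= msymZ !pairing_linear {}IH; congr (_ * _ + _).
rewrite msymX !pairingE !msuppX !big_seq1 !mcoeffX !eqxx mcoeff_sym.
rewrite !mul1r; congr (_ @_ _ *+ _).
  by apply/mnmP=> i; rewrite !mnmE permK.
rewrite (reindex_inj (@perm_inj _ s)) /=.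
by apply: eq_bigr => i _; rewrite mnmE permK.
Qed.

Lemma msym_mderivm (s : 'S_N) g m :
  msym s g^`M[m] = (msym s g)^`M[[multinom m ((s^-1)%g i) | i < N]].
Proof.
apply/mpolyP=> m'; rewrite mcoeff_sym !mcoeff_mderivm mcoeff_sym.
congr (_ @_ _ *+ _).
  by apply/mnmP=> i; rewrite !(mnmE, mnmDE) permK.
rewrite [RHS](reindex_inj (@perm_inj _ s)) /=.
by apply: eq_bigr => i _; rewrite !(mnmE, mnmDE) permK.
Qed.

End Pairing.

Section DiagonalAction.
Variable n : nat.

Notation polyXY := {mpoly rat[n + n]}.

Definition xvar (i : 'I_n) : polyXY := 'X_(lshift n i).
Definition yvar (i : 'I_n) : polyXY := 'X_(rshift n i).

Definition diag_fun (s : 'S_n) (i : 'I_(n + n)) : 'I_(n + n) :=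
  match split i with inl j => lshift n (s j) | inr j => rshift n (s j) end.

Fact diag_fun_inj s : injective (diag_fun s).
Proof.
apply: (can_inj (g := diag_fun s^-1)) => i; rewrite /diag_fun.
case: (splitP i) => j ij.
  by rewrite (unsplitK (inl _)) permK; apply: val_inj.
by rewrite (unsplitK (inr _)) permK; apply: val_inj.
Qed.

Definition diag_perm (s : 'S_n) : 'S_(n + n) := perm (@diag_fun_inj s).

(** The action sigma(x_i) = x_sigma(i), sigma(y_i) = y_sigma(i), written on the
    right since [(s * t) i = t (s i)] for permutations. *)
Definition pact (f : polyXY) (s : 'S_n) : polyXY := msym (diag_perm s) f.

Lemma diag_perml s i : diag_perm s (lshift n i) = lshift n (s i).
Proof. by rewrite permE /diag_fun (unsplitK (inl _)). Qed.

Lemma diag_permr s i : diag_perm s (rshift n i) = rshift n (s i).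
Proof. by rewrite permE /diag_fun (unsplitK (inr _)). Qed.

Lemma pact_xvar s i : pact (xvar i) s = xvar (s i).
Proof. by rewrite /pact /msym mmapX mmap1U diag_perml. Qed.

Lemma pact_yvar s i : pact (yvar i) s = yvar (s i).
Proof. by rewrite /pact /msym mmapX mmap1U diag_permr. Qed.

Lemma diag_permM s t : diag_perm (s * t) = (diag_perm s * diag_perm t)%g.
Proof.
apply/permP=> i; rewrite permM -(splitK i); case: (split i) => j /=.
  by rewrite !diag_perml permM.
by rewrite !diag_permr permM.
Qed.

Lemma pactM f s t : pact f (s * t)%g = pact (pact f s) t.
Proof. by rewrite /pact diag_permM msymMm. Qed.

Lemma pact1 f : pact f 1%g = f.
Proof.
rewrite /pact; suff -> : diag_perm 1 = 1%g by rewrite msym1m.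
apply/permP=> i; rewrite perm1 -(splitK i); case: (split i) => j /=.
  by rewrite diag_perml perm1.
by rewrite diag_permr perm1.
Qed.

End DiagonalAction.

Section GarsiaHaiman.
Variables n k : nat.

(** For the hook (1^(k-1), n-k+1), row [i] is
    [1, y_i, ..., y_i^(n-k), x_i, ..., x_i^(k-1)]. *)
Definition Delta_mx : 'M[{mpoly rat[n + n]}]_n :=
  \matrix_(i < n, j < n)
    if (j <= n - k)%N then yvar i ^+ j else xvar i ^+ (j - (n - k)).

Definition Delta : {mpoly rat[n + n]} := \det Delta_mx.

Definition Hmu : {pred {mpoly rat[n + n]}} :=
  lspan (fun h => exists m : 'X_{1..n + n}, h = Delta^`M[m]).

Definition Jmu : {pred {mpoly rat[n + n]}} := orthogonal_to Hmu.
HB.instance Definition _ := GRing.SubmodClosed.on Jmu.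

Definition Hquot := lquot Jmu.
HB.instance Definition _ := GRing.Lmodule.on Hquot.

Definition Hclass : {mpoly rat[n + n]} -> Hquot := @lclass _ _ Jmu.

Lemma pact_Delta s : pact Delta s = (-1) ^+ s * Delta.
Proof.
rewrite /pact /Delta -det_map_mx -det_perm -det_mulmx -row_permE; congr (\det _).
apply/matrixP=> i j; rewrite !mxE; case: ifP => _.
  by rewrite rmorphXn /= -/(pact _ _) pact_yvar.
by rewrite rmorphXn /= -/(pact _ _) pact_xvar.
Qed.

Lemma pact_Hmu s f : f \in Hmu -> pact f s \in Hmu.
Proof.
case/lspanP=> m [c [v [Sv ->]]]; rewrite /pact raddf_sum /=.
apply: rpred_sum => i _; rewrite msymZ rpredZ //.
case: (Sv i) => e ->; rewrite msym_mderivm -/(pact _ _) pact_Delta.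
rewrite mulr_sign; apply/lspanP; exists 1, (fun=> (-1) ^+ s).
eexists (fun=> _); split; first by move=> _; eexists.
rewrite big_ord1 scaler_sign; case: (odd_perm s) => //.
by rewrite mderivmN.
Qed.

Lemma pact_Jmu s f : f \in Jmu -> pact f s \in Jmu.
Proof.
move=> /orthogonal_toP Jf; apply/orthogonal_toP => g Hg.
rewrite -[g](pact1 g) -(mulVg s) pactM pairing_sym.
by apply: Jf; apply: pact_Hmu.
Qed.

Definition hact_fun (u : Hquot) (s : 'S_n) : Hquot := Hclass (pact (lrepr u) s).

Lemma hact_funE f s : hact_fun (Hclass f) s = Hclass (pact f s).
Proof.
apply/lclassP; rewrite /pact -raddfB; apply: pact_Jmu.
by apply/lclassP; rewrite lreprK.
Qed.

Fact hact_is_action : is_action [set: 'S_n] hact_fun.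
Proof.
have hM u s t : hact_fun u (s * t)%g = hact_fun (hact_fun u s) t.
  by rewrite -[u]lreprK !hact_funE pactM lreprK.
have h1 u : hact_fun u 1%g = u by rewrite -[u]lreprK hact_funE pact1.
split=> [s|u s t _ _]; last exact: hM.
by apply: (can_inj (g := hact_fun^~ s^-1%g)) => u; rewrite -hM mulgV h1.
Qed.

Definition hact : {action 'S_n &-> Hquot} := Action hact_is_action.

Lemma hactE f s : hact (Hclass f) s = Hclass (pact f s).
Proof. exact: hact_funE. Qed.

Lemma hact_is_linear s : linear (hact^~ s).
Proof.
move=> a u v.
have [f ->] : exists f, u = Hclass f by exists (lrepr u); rewrite /Hclass lreprK.
have [g ->] : exists g, v = Hclass g by exists (lrepr v); rewrite /Hclass lreprK.
have Hlin b p q : b *: Hclass p + Hclass q = Hclass (b *: p + q).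
  by rewrite /Hclass lclassD lclassZ.
by rewrite Hlin !hactE Hlin /pact raddfD /= msymZ.
Qed.

Definition Sn_invariant (U : {pred Hquot}) : Prop :=
  forall (s : 'S_n) (u : Hquot), u \in U -> hact u s \in U.

End GarsiaHaiman.

Local Open Scope nat_scope.

(** Positions of [pi] are counted from 1 here: [Des pi i] says that
    1 <= i <= n - 1 and pi(i) > pi(i + 1), position [i] being the ordinal of
    value [i - 1]. *)
Definition Des (n : nat) (pi : 'S_n) : pred nat := fun i =>
  [exists a : 'I_n, exists b : 'I_n,
     [&& i == a.+1, b == a.+1 :> nat & pi b < pi a]].

Definition dexp (n k : nat) (pi : 'S_n) (i : nat) : nat :=
  if i < k then count (Des pi) (index_iota i k)
  else count (Des pi) (index_iota k i).

Definition descent_mon (n k : nat) (pi : 'S_n) : {mpoly rat[n + n]} :=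
  ((\prod_(i < n | (i.+1 < k)%N) xvar (pi i) ^+ dexp k pi i.+1) *
  (\prod_(i < n | (k < i.+1)%N) yvar (pi i) ^+ dexp k pi i.+1))%R.

Definition exp_bipartition (n k : nat) (pi : 'S_n) : seq nat * seq nat :=
  (rcons [seq dexp k pi i | i <- index_iota 1 k] 0,
   rcons [seq dexp k pi i | i <- rev (index_iota k.+1 n.+1)] 0).

Definition unit_step_partition (p : seq nat) : bool :=
  sorted (fun a b => (a == b) || (a == b.+1)) p && (last 0 p == 0).

Definition is_bipartition (n k : nat) (lam : seq nat * seq nat) : bool :=
  [&& size lam.1 == k, size lam.2 == (n - k).+1,
      unit_step_partition lam.1 & unit_step_partition lam.2].

Definition dominated (p q : seq nat) : Prop :=
  sumn p = sumn q /\ forall j, sumn (take j p) <= sumn (take j q).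

Definition bidom (lam1 lam2 : seq nat * seq nat) : Prop :=
  dominated lam1.1 lam2.1 /\ dominated lam1.2 lam2.2.

Definition bidom_strict (lam1 lam2 : seq nat * seq nat) : Prop :=
  bidom lam1 lam2 /\ lam1 <> lam2.

Section DescentModules.
Variables (n k : nat) (lam : seq nat * seq nat).

Definition I_le : {pred Hquot n k} :=
  lspan (fun u => exists pi : 'S_n,
    bidom (exp_bipartition k pi) lam /\ u = Hclass k (descent_mon k pi)).
HB.instance Definition _ := GRing.SubmodClosed.on I_le.

Definition I_lt : {pred Hquot n k} :=
  lspan (fun u => exists pi : 'S_n,
    bidom_strict (exp_bipartition k pi) lam /\ u = Hclass k (descent_mon k pi)).
HB.instance Definition _ := GRing.SubmodClosed.on I_lt.

Lemma I_lt_sub_le : {subset I_lt <= I_le}.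
Proof.
move=> u /lspanP[m [c [v [Sv ->]]]]; apply/lspanP; exists m, c, v.
by split=> // i; have [pi [[lepi _] vE]] := Sv i; exists pi.
Qed.

Definition Rmod := subquot I_le I_lt.
HB.instance Definition _ := GRing.Lmodule.on Rmod.

Definition Rclass : lsub I_le -> Rmod := @lclass _ _ (lsub_in I_lt).

End DescentModules.

(* Main.v *)
Require Import Defs.
From mathcomp Require Import all_boot all_order all_algebra all_fingroup.
From mathcomp Require Import mpoly boolp zify ring.

(** Everything rests on a straightening law in the style of Garsia and Stanton:
    modulo [Jmu], every monomial is a combination of descent monomials whose
    exponents it majorizes, separately in the x's and in the y's ([straighten]).
    Permuting the variables does not change the multiset of exponents, so the
    image of a descent monomial under S_n is a monomial with the same exponent
    bipartition; straightening it only produces descent monomials that are lower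
    in the dominance order ([hact_descent]).  The spans [I_le] and [I_lt] are
    indexed by order ideals for dominance, hence are invariant
    ([Sn_invariant_span]), and an action preserving both descends to their
    quotient.

    The straightening law uses four families of elements of [Jmu].  As each row
    of the determinant [Delta] contributes a power of x_i or a power of y_i,
    [Delta] is killed by x_i y_i ([Jmu_mixed]), by products of [k] distinct x's
    ([Jmu_many_x]) and by products of [n - k + 1] distinct y's ([Jmu_many_y]).
    The elementary symmetric functions of positive degree in the x's or in the
    y's kill it as well ([Jmu_elementary]): they differentiate sets of columns, and each resulting
    determinant has a zero column or two proportional columns.

    A monomial free of products x_i y_i is encoded by the integers
    z_i = deg_{x_i} - deg_{y_i}.  Let pi list the indices by decreasing z, ties
    being listed by increasing index.  By the bounds on the supports, z vanishes
    at position [k].  If each descent of pi lowers z by 1 and each ascent leaves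
    it constant, then the monomial is the descent monomial of pi
    ([descent_mnm_of_steps]).  Otherwise z drops too much between two successive
    positions.  Let T be the set of indices before the drop if it occurs on the
    x side, after it if it occurs on the y side, and divide the monomial by the
    product of the variables of T.  Multiplying the quotient by the elementary
    symmetric function of degree |T| gives an element of [Jmu], in which the
    original monomial is the term of T ([Hclass_exchange]).  The other terms have
    majorized exponents ([majorized_transfer]) and a smaller value of
    sum_i (n z_i^2 - 2 i z_i) ([potential_transfer]), an integer bounded below,
    so induction applies ([straighten_step]).  The quadratic part of this
    potential decreases when exponents are balanced; the linear part decides
    between monomials with the same multiset of exponents. *)

Set Implicit Arguments.
Unset Strict Implicit.
Unset Printing Implicit Defensive.

Import Order.TTheory GRing.Theory Num.Theory.
Local Open Scope ring_scope.

(** * Majorization *)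

Section Majorization.
Variable n : nat.
Implicit Types (a b c : 'I_n -> nat) (S T : {set 'I_n}).

(** Majorization of multisets of exponents, expressed by thresholds rather than
    by partial sums of sorted sequences: this form is visibly symmetric and
    transitive, and needs no sorting. *)
Definition majorized a b : Prop :=
  \sum_j a j = \sum_j b j /\
  forall v : nat, (\sum_j (a j - v)%N <= \sum_j (b j - v)%N)%N.

Lemma majorized_eq a b : a =1 b -> majorized a b.
Proof. by move=> /funext ->. Qed.

Lemma majorized_trans b a c : majorized a b -> majorized b c -> majorized a c.
Proof.
case=> [ab abv] [bc bcv]; split=> [|v]; first by rewrite ab.
exact: leq_trans (abv v) (bcv v).
Qed.

Lemma majorized_perm a (s : 'S_n) : majorized (a \o s) a.
Proof.
split=> [|v]; first by rewrite [RHS](reindex_inj (@perm_inj _ s)).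
by rewrite [leqRHS](reindex_inj (@perm_inj _ s)).
Qed.

Lemma sum_addn_mem a S (P : pred 'I_n) :
  (\sum_j (a j + ((j \in S) && P j))%N = \sum_j a j + #|[set j in S | P j]|)%N.
Proof.
rewrite big_split /=; congr addn; rewrite -sum1_card [RHS]big_mkcond /=.
by apply: eq_bigr => j _; rewrite inE; case: (_ && _).
Qed.

(** Once 1 is removed from the entries in [T], the entries in [T] are still the
    largest, so among the sets of this size it is [T] that contains the most
    entries above any given threshold; adding 1 on [S] thus increases each
    threshold sum by no more than adding it back on [T]. *)
Lemma majorized_transfer a S T :
  #|S| = #|T| -> {in T, forall j, 0 < a j}%N ->
  (forall j l, j \in T -> l \notin T -> a l < a j)%N ->
  majorized (fun j => a j - (j \in T) + (j \in S))%N a.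
Proof.
move=> eqST Tpos Ttop; pose b j := (a j - (j \in T))%N.
have aE j : a j = (b j + (j \in T))%N.
  by rewrite /b; case: (boolP (j \in T)) => [/Tpos|]; lia.
have sumE v (U : {set 'I_n}) : (\sum_j (b j + (j \in U) - v)%N =
    \sum_j (b j - v)%N + #|[set j in U | (v <= b j)%N]|)%N.
  rewrite -(sum_addn_mem (fun j => (b j - v)%N) U (fun j => (v <= b j)%N)).
  apply: eq_bigr => j _.
  by case: (j \in U) => /=; case: (leqP v (b j)) => /=; lia.
have aE' v : (\sum_j (a j - v)%N =
    \sum_j (b j - v)%N + #|[set j in T | (v <= b j)%N]|)%N.
  by rewrite -sumE; apply: eq_bigr => j _; rewrite -aE.
have sum0 (f : 'I_n -> nat) : (\sum_j f j = \sum_j (f j - 0)%N)%N.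
  by apply: eq_bigr => j _; rewrite subn0.
have set0E (U : {set 'I_n}) : #|[set j in U | (0 <= b j)%N]| = #|U|.
  by apply: eq_card => j; rewrite !inE andbT.
split=> [|v].
  by rewrite [LHS](sum0 (fun j => (b j + (j \in S))%N)) [RHS]sum0 sumE aE' !set0E eqST.
rewrite (sumE v S) aE' leq_add2l.
(* If some entry in [T] is below the threshold, all entries outside are. *)
case: (boolP [forall j in T, v <= b j])%N => [/forall_inP Tv | ].
  apply: (@leq_trans #|S|).
    by apply/subset_leq_card/subsetP=> j; rewrite inE => /andP[].
  by rewrite eqST; apply/subset_leq_card/subsetP => j Tj; rewrite inE Tj Tv.
rewrite negb_forall_in => /exists_inP[j Tj]; rewrite -ltnNge => bj.
apply/subset_leq_card/subsetP => l; rewrite !inE => /andP[_ vl].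
rewrite vl andbT; apply: contraLR vl => nTl.
have := Ttop j l Tj nTl; rewrite -ltnNge /b (negbTE nTl) subn0.
by move: bj; rewrite /b Tj; lia.
Qed.

(** After cancelling the common part, the smallest weight of [T :\: S] exceeds
    every weight of [S :\: T], and these sets have the same nonzero size. *)
Lemma sum_lt_top (w : 'I_n -> int) S T : #|S| = #|T| -> S != T ->
  (forall j l, j \in T -> l \notin T -> w l < w j) ->
  \sum_(j in S) w j < \sum_(j in T) w j.
Proof.
move=> eqST neST Ttop.
rewrite (big_setID T) [ltRHS](big_setID S) /= setIC ltrD2l.
have cardD : #|S :\: T| = #|T :\: S|.
  by have := cardsID T S; have := cardsID S T; rewrite setIC eqST; lia.
have [j0 Tj0] : exists j0, j0 \in T :\: S.
  apply/set0Pn; apply: contra neST; rewrite setD_eq0 => TS.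
  by rewrite eq_sym eqEcard TS eqST /=.
have [j1 Tj1 minj1] := arg_minP w Tj0.
have /setDP[{}Tj1 _] : j1 \in T :\: S by exact: Tj1.
apply: (@le_lt_trans _ _ (\sum_(j in S :\: T) (w j1 - 1))).
  apply: ler_sum => l; rewrite inE => /andP[nTl _].
  by have := Ttop j1 l Tj1 nTl; lia.
apply: (@lt_le_trans _ _ (\sum_(j in T :\: S) w j1)); last first.
  by apply: ler_sum => l Tl; exact: minj1.
rewrite !sumr_const cardD ltrMn2r; apply/andP; split; last by lia.
by rewrite lt0n cards_eq0; apply/set0Pn; exists j0.
Qed.

Lemma exists_sorting_perm (w : 'I_n -> int) : injective w ->
  exists s : 'S_n, forall p q : 'I_n, (p < q)%N -> w (s q) < w (s p).
Proof.
move=> w_inj; pose r := [rel i j : 'I_n | w j <= w i].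
have : perm_eq (sort r (enum 'I_n)) (ord_tuple n) by rewrite perm_sort val_ord_tuple.
case/tuple_permP=> s es; exists s => p q ltpq.
have nthE (i : 'I_n) : nth p (sort r (enum 'I_n)) i = s i.
  rewrite es -[RHS](tnth_ord_tuple) (tnth_nth p) /=.
  by rewrite (nth_map p) ?size_enum_ord // nth_ord_enum (tnth_nth p).
have szE : size (sort r (enum 'I_n)) = n by rewrite size_sort size_enum_ord.
rewrite lt_neqAle; apply/andP; split.
  by apply/eqP => /w_inj /perm_inj eqqp; rewrite eqqp ltnn in ltpq.
have srt : sorted r (sort r (enum 'I_n)) by apply: sort_sorted => i j; exact: le_total.
rewrite -!nthE; apply: (sorted_leq_nth _ _ p srt) => //; rewrite ?inE ?szE //; last exact: ltnW.
  by move=> i j l /= h1 h2; exact: le_trans h2 h1.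
by move=> i /=.
Qed.

Lemma card_pred_perm_le (s : 'S_n) (P : pred 'I_n) (a b : nat) :
  (forall i, P i -> a <= s i < b)%N -> (#|P| <= b - a)%N.
Proof.
move=> Pab; rewrite -(size_iota a (b - a)) cardE.
rewrite -(size_map (fun i : 'I_n => s i : nat) (enum P)).
apply: uniq_leq_size; first by rewrite map_inj_uniq ?enum_uniq // => i l /val_inj/perm_inj.
by move=> _ /mapP[i + ->]; rewrite mem_enum mem_index_iota => /Pab.
Qed.

End Majorization.

(** With [v] the [j]-th entry of [q], the sum of the first [j] entries is at most
    [j * v] plus the sum of the excesses over [v]; the sorted sequence [q] attains
    this bound. *)
Lemma dominated_of_thresholds (p q : seq nat) :
  sorted geq q -> sumn p = sumn q ->
  (forall v, sumn [seq (x - v)%N | x <- p] <= sumn [seq (x - v)%N | x <- q])%N ->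
  dominated p q.
Proof.
move=> sq eqpq le_pq; split=> // j.
have [ltj | gej] := ltnP j (size q); last first.
  rewrite [X in (_ <= sumn X)%N]take_oversize // -eqpq -[in leqRHS](cat_take_drop j p).
  by rewrite sumn_cat leq_addr.
have upper v (s : seq nat) i :
    (sumn (take i s) <= i * v + sumn [seq (x - v)%N | x <- s])%N.
  elim: s i => [|x s IH] [|i] //=; have := IH i; rewrite ?mulSn; lia.
have lower v (s : seq nat) : all (fun x => v <= x)%N s ->
    (sumn s = size s * v + sumn [seq (x - v)%N | x <- s])%N.
  by elim: s => [|x s IH] //= /andP[vx /IH]; rewrite mulSn; lia.
set v := nth 0%N q j.
apply: leq_trans (upper v p j) _; apply: leq_trans (leq_add (leqnn _) (le_pq v)) _.
rewrite -[q in X in (_ + sumn X)%N](cat_take_drop j q) map_cat sumn_cat.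
have qtr : transitive geq by move=> x y z /= h1 h2; exact: leq_trans h2 h1.
have dropE : drop j q = v :: drop j.+1 q by rewrite (drop_nth 0%N ltj).
have : pairwise geq (take j q ++ v :: drop j.+1 q).
  by rewrite -dropE cat_take_drop -sorted_pairwise.
rewrite pairwise_cat /= => /and3P[/allrelP take_ge _ /andP[/allP drop_le _]].
have -> : sumn [seq (x - v)%N | x <- drop j q] = 0%N.
  have : all (fun x => x <= v)%N (drop j q).
    by rewrite dropE /= leqnn; apply/allP => x /drop_le.
  elim: (drop j q) => [//|x t IH] /= /andP[xv /IH ->].
  by rewrite addn0; apply/eqP.
have : all (fun x => v <= x)%N (take j q).
  by apply/allP => x /take_ge; apply; rewrite inE eqxx.
have : size (take j q) = j by rewrite size_take_min; apply/minn_idPl/ltnW.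
by move=> sz /(lower v); rewrite sz addn0 => <-.
Qed.

Lemma dominated_antisym (p q : seq nat) : size p = size q ->
  dominated p q -> dominated q p -> p = q.
Proof.
move=> eqsz [_ pq] [_ qp].
have E j : sumn (take j p) = sumn (take j q) by apply/eqP; rewrite eqn_leq pq qp.
apply: (@eq_from_nth _ 0%N) => // j ltj.
have := E j.+1; rewrite !(take_nth 0%N) -?eqsz // !sumn_rcons E.
by move/addnI.
Qed.

Lemma dominated_trans (q p r : seq nat) :
  dominated p q -> dominated q r -> dominated p r.
Proof.
case=> [pq pqj] [qr qrj]; split=> [|j]; first by rewrite pq.
exact: leq_trans (pqj j) (qrj j).
Qed.

Lemma bidom_trans l2 l1 l3 : bidom l1 l2 -> bidom l2 l3 -> bidom l1 l3.
Proof. by move=> [a b] [c d]; split; apply: dominated_trans; eassumption. Qed.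

Lemma bidom_antisym (l1 l2 : seq nat * seq nat) :
  size l1.1 = size l2.1 -> size l1.2 = size l2.2 -> bidom l1 l2 -> bidom l2 l1 -> l1 = l2.
Proof.
case: l1 l2 => [a b] [c d] /= sac sbd [ac bd] [ca db].
by rewrite (dominated_antisym sac ac ca) (dominated_antisym sbd bd db).
Qed.

Lemma sorted_rcons0 (s : seq nat) : sorted geq s -> sorted geq (rcons s 0%N).
Proof. by case: s => // a s /= ps; rewrite rcons_path ps /=. Qed.

Lemma sorted_map_iota (r : rel nat) (f : nat -> nat) a b :
  (forall i, a <= i -> i.+1 < b -> r (f i) (f i.+1))%N ->
  sorted r [seq f i | i <- index_iota a b].
Proof.
rewrite /index_iota; have [c cE] : exists c, (b - a)%N = c by eexists.
rewrite cE; elim: c a cE => [//|[//|c] IH] a cE fle /=.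
rewrite fle //=; last lia.
by apply: (IH a.+1) => [|i ai]; [lia | apply: fle; lia].
Qed.

(** * Linear spans *)

Lemma linear_sum (K : nzRingType) (V W : lmodType K) (f : V -> W) :
  linear f -> forall p (c : 'I_p -> K) (h : 'I_p -> V),
  f (\sum_i c i *: h i) = \sum_i c i *: f (h i).
Proof.
move=> flin p c h; have f0 : f 0 = 0.
  by have := flin (-1) 0 0; rewrite !scaleN1r !addNr.
by elim/big_rec2: _ => [//|i y x _ <-]; exact: flin.
Qed.

Lemma lspan_mono (K : nzRingType) (V : lmodType K) (S S' : V -> Prop) u :
  (forall v, S v -> S' v) -> u \in lspan S -> u \in lspan S'.
Proof.
move=> SS /lspanP[p [c [h [Sh ->]]]]; apply/lspanP; exists p, c, h.
by split=> // i; apply: SS.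
Qed.

(** * A potential for the straightening *)

Section Potential.
Variable n : nat.
Implicit Types (z : 'I_n -> int) (S T : {set 'I_n}).

(** As indices are smaller than [n], ordering by [weight] amounts to ordering by
    [z], with ties in favour of the smaller index; distinct indices get distinct
    weights. *)
Definition weight z (j : 'I_n) : int := n%:Z * z j - (j : nat)%:Z.

(** The derivative of the [j]-th term along [z j] is twice [weight z j], so that
    moving units towards smaller weights decreases the sum. *)
Definition potential z : int :=
  \sum_j (n%:Z * z j ^+ 2 - 2 * (j : nat)%:Z * z j).

Lemma weight_inj z : injective (weight z).
Proof.
move=> i j; rewrite /weight => eqw.
have := ltn_ord i; have := ltn_ord j => ltj lti.
have [lt|gt|eqz] := ltrgtP (z i) (z j); [nia|nia|].
by move: eqw; rewrite eqz => /addrI/oppr_inj[] /val_inj.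
Qed.

Lemma weight_le z i j : weight z i <= weight z j -> z i <= z j.
Proof. by rewrite /weight leNgt => + ; have := ltn_ord i; have := ltn_ord j; nia. Qed.

Lemma weight_gap z i j : weight z i + n%:Z < weight z j -> z i < z j.
Proof. by rewrite /weight; have := ltn_ord i; have := ltn_ord j; nia. Qed.

Lemma potential_ge z : 0 <= potential z + n%:Z * n%:Z.
Proof.
have -> : n%:Z * n%:Z = \sum_(j < n) n%:Z.
  by rewrite sumr_const card_ord -mulr_natr natz.
rewrite -big_split /=; apply: sumr_ge0 => j _.
set c := z j; set i := (j : nat)%:Z.
(* Completing squares with nonnegative coefficients, since i <= n. *)
have -> : n%:Z * c ^+ 2 - 2 * i * c + n%:Z =
    (n%:Z - i) * (c ^+ 2 + 1) + i * (c - 1) ^+ 2 by ring.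
have i_le : 0 <= n%:Z - i by rewrite /i; have := ltn_ord j; lia.
by rewrite addr_ge0 // mulr_ge0 // ?addr_ge0 ?sqr_ge0.
Qed.

(** The sign [e] is 1 when units of x-degree are moved, -1 for units of y-degree.
    The gap [n] between the weights outside and inside [T] absorbs the change of
    weight caused by removing one unit on [T], so [T] remains the extremal set of
    its size for the modified weights. *)
Lemma potential_transfer z (e : int) S T : e * e = 1 ->
  #|S| = #|T| -> S != T ->
  (forall j l, j \in T -> l \notin T -> e * weight z l + n%:Z < e * weight z j) ->
  potential (fun j => z j - e * (j \in T)%:R + e * (j \in S)%:R) < potential z.
Proof.
move=> ee cardST neST gap.
have nee : n%:Z = n%:Z * (e * e) by rewrite ee mulr1.
pose z' j := z j - e * (j \in T)%:R.
pose u j := n%:Z + 2 * (e * weight z' j).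
have potE (U : {set 'I_n}) :
    potential (fun j => z' j + e * (j \in U)%:R) = potential z' + \sum_(j in U) u j.
  rewrite [in RHS]big_mkcond -big_split; apply: eq_bigr => j _ /=.
  rewrite /u /weight; case: (j \in U); rewrite /= ?mulr0n ?mulr1n ?mulr0 ?addr0 //.
  by rewrite mulr1 [X in X + 2 * _]nee; ring.
have -> : potential z = potential (fun j => z' j + e * (j \in T)%:R).
  by apply: eq_bigr => j _; rewrite /z' subrK.
rewrite !potE ltrD2l; apply: sum_lt_top => // j l Tj nTl.
have := gap j l Tj nTl; rewrite /u /weight /z' Tj (negbTE nTl) mulr1n mulr0n mulr1 mulr0 subr0.
have -> : e * (n%:Z * (z j - e) - (j : nat)%:Z) = e * (n%:Z * z j - (j : nat)%:Z) - n%:Z.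
  by rewrite [X in _ = _ - X]nee; ring.
by lia.
Qed.

End Potential.

(** * Derivatives of determinants *)

Section DeterminantDerivatives.
Variables n N : nat.
Implicit Types (v : 'I_n -> 'I_N) (S : {set 'I_n}).

(** The exponent of the product of the variables [v i], [i] in [S]. *)
Definition set_mnm v S : 'X_{1..N} := (\sum_(i in S) U_(v i))%MM.

Lemma mderiv_prod_eq0 (I : Type) (r : seq I) (P : pred I) (F : I -> {mpoly rat[N]}) i :
  (forall l, P l -> (F l)^`M(i) = 0) -> (\prod_(l <- r | P l) F l)^`M(i) = 0.
Proof.
move=> F0; elim/big_rec: _ => [|l p Pl IH]; first by rewrite -mpolyC1 mderivC.
by rewrite mderivM IH F0 // mul0r mulr0 addr0.
Qed.

Lemma mderivm_prod v (F : 'I_n -> {mpoly rat[N]}) S :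
  (forall i l, i != l -> (F l)^`M(v i) = 0) ->
  (\prod_i F i)^`M[set_mnm v S] =
  \prod_i (if i \in S then (F i)^`M(v i) else F i).
Proof.
move=> F0; elim: {S}#|S| {-2}S (eqxx #|S|) => [|r IH] S cardS.
  move: cardS; rewrite cards_eq0 => /eqP ->.
  rewrite /set_mnm big_set0 mderivm0m.
  by apply: eq_bigr => i _; rewrite inE.
have [i0 Si0] : exists i0, i0 \in S by apply/set0Pn; rewrite -cards_eq0 (eqP cardS).
have cardD : #|S :\ i0| == r by move: cardS; rewrite (cardsD1 i0) Si0.
rewrite /set_mnm (big_setD1 i0) //= addmC mderivmDm -/(set_mnm v _) IH //.
rewrite mderivmU1m (bigD1 i0) //= [RHS](bigD1 i0) //= Si0 !inE eqxx /=.
rewrite mderivM [X in _ + _ * X]mderiv_prod_eq0 => [|l nel]; last first.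
  by case: ifP => _; rewrite 1?mderiv_comm F0 ?mderiv0 // eq_sym.
rewrite mulr0 addr0; congr (_ * _); apply: eq_bigr => l nel.
by rewrite !inE nel.
Qed.

(** The elementary symmetric differential operator of degree [r] distributes
    over the Leibniz expansion.  Indexing by the set [C] of columns that are
    differentiated, instead of the set [S] of rows, turns the sum into a sum of
    determinants.  For the least column [j] of [C], either the differentiated
    column is zero, or it is a multiple of some column [j' < j], which is not in
    [C] and hence still present. *)
Lemma sum_mderivm_det v (M : 'M[{mpoly rat[N]}]_n) r :
  (forall i l j, i != l -> (M l j)^`M(v i) = 0) ->
  (forall j : 'I_n, (forall i, (M i j)^`M(v i) = 0) \/
     exists2 j' : 'I_n, (j' < j)%N &
       exists c, forall i, (M i j)^`M(v i) = c * M i j') ->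
  (0 < r)%N ->
  \sum_(S : {set 'I_n} | #|S| == r) (\det M)^`M[set_mnm v S] = 0.
Proof.
move=> M0 Mlow r_gt0.
pose MC (C : {set 'I_n}) :=
  \matrix_(i, j) (if j \in C then (M i j)^`M(v i) else M i j).
have detE S : (\det M)^`M[set_mnm v S] = \sum_(s : 'S_n) (-1) ^+ s *
    \prod_i (if i \in S then (M i (s i))^`M(v i) else M i (s i)).
  rewrite /determinant raddf_sum; apply: eq_bigr => s _ /=.
  rewrite -mderivm_prod => [|i l]; last exact: M0.
  by rewrite !mulr_sign; case: (odd_perm s); rewrite ?mderivmN.
under eq_bigr do rewrite detE.
rewrite exchange_big /=.
(* In the term of the permutation [s], rows and columns match by [C = s @: S]. *)
have preim_bij (s : 'S_n) : bijective (fun C : {set 'I_n} => s @^-1: C).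
  exists (fun C : {set 'I_n} => s^-1%g @^-1: C) => C; apply/setP => i.
    by rewrite !inE permKV.
  by rewrite !inE permK.
transitivity (\sum_(s : 'S_n) \sum_(C : {set 'I_n} | #|C| == r)
    (-1) ^+ s * \prod_i MC C i (s i)).
  apply: eq_bigr => s _; rewrite (reindex _ (onW_bij _ (preim_bij s))) /=.
  apply: eq_big => [C|C _]; first by rewrite card_preimset //; exact: perm_inj.
  by congr (_ * _); apply: eq_bigr => i _; rewrite mxE inE.
rewrite exchange_big big1 //= => C /eqP cardC.
rewrite -/(\det (MC C)).
have [j0 Cj0] : exists j0, j0 \in C by apply/set0Pn; rewrite -card_gt0 cardC.
have [j Cj minj] := arg_minnP (fun j : 'I_n => j : nat) Cj0.
have {}Cj : j \in C by exact: Cj.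
have [col0 | [j' ltj' [c colE]]] := Mlow j.
  rewrite (expand_det_col _ j) big1 // => i _.
  by rewrite mxE Cj col0 mul0r.
have nCj' : j' \notin C by apply: contraL ltj' => /minj; rewrite -leqNgt.
pose B := \matrix_(i, l) MC C i (if l == j then j' else l).
rewrite -det_tr (@determinant_multilinear _ _ _ B^T B^T j c 0).
- rewrite mul0r addr0 (determinant_alternate (i1 := j) (i2 := j')) ?mulr0 //.
    by apply: contraTneq Cj => ->.
  by move=> i; rewrite !mxE eqxx; case: (j' == j).
- rewrite scale0r addr0; apply/rowP => i; rewrite !mxE Cj eqxx (negbTE nCj').
  exact: colE.
- by apply/matrixP=> a b; rewrite !mxE eq_sym (negbTE (neq_lift _ _)).
- by apply/matrixP=> a b; rewrite !mxE eq_sym (negbTE (neq_lift _ _)).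
Qed.

End DeterminantDerivatives.

Section HookShape.
Variables n k : nat.
Hypotheses (k_gt0 : (0 < k)%N) (le_kn : (k <= n)%N).

Notation mnm := 'X_{1..n + n}.
Notation x_ := (@lshift n n).
Notation y_ := (@rshift n n).

(** * The ideal of the hook *)

(** Differential operators commute, so a polynomial whose operator kills [Delta]
    is orthogonal to all derivatives of [Delta], and so are its multiples. *)
Lemma Jmu_sum (I : finType) (P : pred I) (e : I -> mnm) (m : mnm) :
  \sum_(i | P i) (Delta n k)^`M[e i] = 0 ->
  \sum_(i | P i) 'X_[m + e i] \in @Jmu n k.
Proof.
move=> e0; apply/orthogonal_toP => g /lspanP[p [c [h [Sh ->]]]].
have pairX (m' : mnm) f : pairing 'X_[m'] f = (f^`M[m'])@_0.
  by rewrite /pairing /diffop msuppX big_seq1 mcoeffX eqxx scale1r.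
have pairD (f : {mpoly rat[n + n]}) : {morph (@pairing (n + n))^~ f : q1 q2 / q1 + q2}.
  by move=> q1 q2; have := pairing_linear f 1 q1 q2; rewrite scale1r mul1r.
have pair0 (f : {mpoly rat[n + n]}) : pairing 0 f = 0 by rewrite pairingE msupp0 big_nil.
rewrite (big_morph ((@pairing (n + n))^~ _) (pairD _) (pair0 _)).
under eq_bigr do rewrite pairX.
rewrite -raddf_sum /= (_ : \sum_(i | P i) _ = 0) ?mcoeff0 //.
rewrite [LHS](eq_bigr _ (fun i _ => raddf_sum (mderivm (m + e i)%MM) _ _ _)) /=.
rewrite exchange_big big1 //= => j _; have [d ->] := Sh j.
under eq_bigr => i _ do rewrite mderivmZ -mderivmDm addmA [(_ + e i)%MM]addmC mderivmDm.
by rewrite -scaler_sumr -raddf_sum e0 raddf0 scaler0.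
Qed.

Lemma Jmu_mnm (m : mnm) : (Delta n k)^`M[m] = 0 -> 'X_[m] \in @Jmu n k.
Proof.
move=> m0; have := @Jmu_sum unit predT (fun=> m) 0%MM.
by rewrite !big_const card_unit /= !addr0 add0m; apply.
Qed.

Definition entry_mnm (i j : 'I_n) : mnm :=
  if (j <= n - k)%N then (U_(y_ i) *+ j)%MM else (U_(x_ i) *+ (j - (n - k)))%MM.

Lemma Delta_mxE i j : Delta_mx n k i j = 'X_[entry_mnm i j].
Proof. by rewrite mxE /entry_mnm; case: ifP => _; rewrite mpolyXn. Qed.

Lemma entry_mnm_x l i j :
  entry_mnm l j (x_ i) = ((l == i) * (j - (n - k)))%N.
Proof.
rewrite /entry_mnm; case: ifP => le; rewrite mulmnE mnm1E.
  by rewrite eq_rlshift (eqP le) muln0.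
by rewrite eq_lshift.
Qed.

Lemma entry_mnm_y l i j :
  entry_mnm l j (y_ i) = ((l == i) * (if j <= n - k then j : nat else 0))%N.
Proof.
rewrite /entry_mnm; case: ifP => le; rewrite mulmnE mnm1E ?eq_rshift //.
by rewrite eq_lrshift muln0.
Qed.

(** A derivative kills [Delta] as soon as it differentiates, in every term of the
    Leibniz expansion, some variable more often than it occurs there. *)
Lemma Delta_mderivm_eq0 (m : mnm) :
  (forall s : 'S_n, exists i : 'I_n, entry_mnm i (s i) (x_ i) < m (x_ i) \/
     entry_mnm i (s i) (y_ i) < m (y_ i))%N ->
  (Delta n k)^`M[m] = 0.
Proof.
move=> small; rewrite /Delta /determinant raddf_sum big1 //= => s _.
rewrite mulr_sign (fun_if (mderivm m)) mderivmN.
suff -> : (\prod_i Delta_mx n k i (s i))^`M[m] = 0 by rewrite oppr0 if_same.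
under eq_bigr do rewrite Delta_mxE.
rewrite mprodXE mderivmX.
suff [v] : exists v, ((\sum_i entry_mnm i (s i))%MM v < m v)%N.
  by move=> lt; rewrite (bigD1 v) //= ffact_small // mul0n scale0r.
have [i [lt|lt]] := small s; [exists (x_ i) | exists (y_ i)].
  rewrite mnm_sumE (bigD1 i) //= big1 ?addn0 // => l nel.
  by rewrite entry_mnm_x (negbTE nel).
rewrite mnm_sumE (bigD1 i) //= big1 ?addn0 // => l nel.
by rewrite entry_mnm_y (negbTE nel).
Qed.

Lemma Jmu_mixed (m : mnm) i : (0 < m (x_ i))%N -> (0 < m (y_ i))%N -> 'X_[m] \in @Jmu n k.
Proof.
move=> mx my; apply/Jmu_mnm/Delta_mderivm_eq0 => s; exists i.
rewrite entry_mnm_x entry_mnm_y eqxx !mul1n.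
by case: (leqP (s i) (n - k)) => h; [left | right]; lia.
Qed.

(** In each term of the expansion of [Delta] only the [k - 1] rows sent to the
    last columns involve an x. *)
Lemma Jmu_many_x (m : mnm) :
  (k <= #|[pred i | 0 < m (x_ i)]|)%N -> 'X_[m] \in @Jmu n k.
Proof.
move=> many; apply/Jmu_mnm/Delta_mderivm_eq0 => s.
have [[i lt]|none] := pselect (exists i, entry_mnm i (s i) (x_ i) < m (x_ i))%N.
  by exists i; left.
suff : (#|[pred i | 0 < m (x_ i)]| <= n - (n - k).+1)%N by lia.
apply: (card_pred_perm_le (s := s)) => i /= mi; rewrite ltn_ord andbT ltnNge.
apply/negP => le; apply: none; exists i.
by rewrite entry_mnm_x (eqP le) muln0.
Qed.

(** In each term of the expansion of [Delta] only the [n - k] rows sent to the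
    columns 1 to [n - k] involve a y. *)
Lemma Jmu_many_y (m : mnm) :
  (n - k < #|[pred i | 0 < m (y_ i)]|)%N -> 'X_[m] \in @Jmu n k.
Proof.
move=> many; apply/Jmu_mnm/Delta_mderivm_eq0 => s.
have [[i lt]|none] := pselect (exists i, entry_mnm i (s i) (y_ i) < m (y_ i))%N.
  by exists i; right.
suff : (#|[pred i | 0 < m (y_ i)]| <= (n - k).+1 - 1)%N by lia.
apply: (card_pred_perm_le (s := s)) => i /= mi; apply: contra_notT none => bad.
by exists i; rewrite entry_mnm_y eqxx mul1n; case: ifP => le; lia.
Qed.

Lemma Jmu_elementary (v : 'I_n -> 'I_(n + n)) (m : mnm) (r : nat) :
  v = x_ \/ v = y_ -> (0 < r)%N ->
  \sum_(S : {set 'I_n} | #|S| == r) 'X_[m + set_mnm v S] \in @Jmu n k.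
Proof.
move=> vxy r_gt0; apply/Jmu_sum/sum_mderivm_det => // [i l j neil|j].
  rewrite Delta_mxE mderivX.
  by case: vxy => ->; rewrite ?entry_mnm_x ?entry_mnm_y eq_sym (negbTE neil) scale0r.
pose D i := (Delta_mx n k i j)^`M(v i).
have DE i : D i = (entry_mnm i j (v i))%:R *: 'X_[entry_mnm i j - U_(v i)].
  by rewrite /D Delta_mxE mderivX.
have step (j' : 'I_n) c : (j' < j)%N -> (forall i, entry_mnm i j (v i) = c) ->
    (forall i, entry_mnm i j - U_(v i) = entry_mnm i j')%MM ->
    exists2 j' : 'I_n, (j' < j)%N & exists c, forall i, D i = c * Delta_mx n k i j'.
  move=> lt ec ej'; exists j' => //; exists (c%:R%:MP) => i.
  by rewrite mul_mpolyC DE Delta_mxE ej' ec.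
case: vxy => vE; rewrite {}vE in D DE step *; last first.
  have [j0|j0] := posnP (j : nat).
    left=> i; rewrite -/(D i) DE entry_mnm_y eqxx mul1n j0.
    by rewrite leq0n scale0r.
  have [gtj|lej] := ltnP (n - k) j.
    by left=> i; rewrite -/(D i) DE entry_mnm_y leqNgt gtj muln0 scale0r.
  right; have ltj' : (j.-1 < n)%N by have := ltn_ord j; lia.
  apply: (step (Ordinal ltj') j) => /= [|i|i]; first by rewrite prednK.
    by rewrite entry_mnm_y eqxx lej mul1n.
  rewrite /entry_mnm lej /= ifT; last lia.
  by apply/mnmP=> l; rewrite mnmBE !mulmnE mnm1E; case: (_ == l); lia.
have [gtj|lej] := ltnP (n - k) j; last first.
  by left=> i; rewrite -/(D i) DE entry_mnm_x (eqP lej) muln0 scale0r.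
right; have n_gt0 : (0 < n)%N by lia.
(* The derivative of the column of x_i is constant, thus a multiple of column 0. *)
have ltj' : ((if j == (n - k).+1 :> nat then 0 else j.-1) < n)%N.
  by have := ltn_ord j; case: ifP; lia.
apply: (step (Ordinal ltj') (j - (n - k))%N) => /= [|i|i].
- by case: eqP; lia.
- by rewrite entry_mnm_x eqxx mul1n.
rewrite /entry_mnm leqNgt gtj /=; case: eqP => [jE|jE] /=.
  by apply/mnmP=> l; rewrite mnmBE !mulmnE !mnm1E; case: (_ == l); lia.
rewrite ifN; last lia.
by apply/mnmP=> l; rewrite mnmBE !mulmnE !mnm1E; case: (_ == l); lia.
Qed.

(** * Straightening modulo the ideal *)

Lemma set_mnm_x S i : set_mnm x_ S (x_ i) = (i \in S).
Proof.
rewrite mnm_sumE big_mkcond (bigD1 i) //= big1 => [|l nel].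
  by rewrite mnm1E eqxx addn0; case: (i \in S).
by rewrite mnm1E eq_lshift (negbTE nel) if_same.
Qed.

Lemma set_mnm_y S i : set_mnm y_ S (y_ i) = (i \in S).
Proof.
rewrite mnm_sumE big_mkcond (bigD1 i) //= big1 => [|l nel].
  by rewrite mnm1E eqxx addn0; case: (i \in S).
by rewrite mnm1E eq_rshift (negbTE nel) if_same.
Qed.

Lemma set_mnm_xy S i : set_mnm x_ S (y_ i) = 0%N.
Proof. by rewrite mnm_sumE big1 // => l _; rewrite mnm1E eq_lrshift. Qed.

Lemma set_mnm_yx S i : set_mnm y_ S (x_ i) = 0%N.
Proof. by rewrite mnm_sumE big1 // => l _; rewrite mnm1E eq_rlshift. Qed.

(** Without mixed products x_j y_j in [m], this integer determines both
    exponents, and one permutation sorts the x's and the y's together. *)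
Definition zexp (m : mnm) (j : 'I_n) : int := (m (x_ j))%:Z - (m (y_ j))%:Z.

Definition mnm_majorized (m1 m2 : mnm) : Prop :=
  majorized (m1 \o x_) (m2 \o x_) /\ majorized (m1 \o y_) (m2 \o y_).

Lemma mnm_majorized_trans m2 m1 m3 :
  mnm_majorized m1 m2 -> mnm_majorized m2 m3 -> mnm_majorized m1 m3.
Proof. by move=> [x12 y12] [x23 y23]; split; apply: majorized_trans; eassumption. Qed.

Definition descent_mnm (pi : 'S_n) : mnm :=
  (\sum_(i < n | (i.+1 < k)%N) U_(x_ (pi i)) *+ dexp k pi i.+1 +
   \sum_(i < n | (k < i.+1)%N) U_(y_ (pi i)) *+ dexp k pi i.+1)%MM.

Lemma descent_monE pi : descent_mon k pi = 'X_[descent_mnm pi].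
Proof. by rewrite /descent_mon !mprodXnE -mpolyXD. Qed.

Lemma descent_mnm_x pi i :
  descent_mnm pi (x_ (pi i)) = if (i.+1 < k)%N then dexp k pi i.+1 else 0%N.
Proof.
rewrite mnmDE !mnm_sumE [X in (_ + X)%N]big1 ?addn0 => [|l _]; last first.
  by rewrite mulmnE mnm1E eq_rlshift.
rewrite big_mkcond (bigD1 i) //= big1 => [|l nel].
  by rewrite addn0 mulmnE mnm1E eqxx mul1n.
by rewrite mulmnE mnm1E eq_lshift (inj_eq perm_inj) (negbTE nel) if_same.
Qed.

Lemma descent_mnm_y pi i :
  descent_mnm pi (y_ (pi i)) = if (k < i.+1)%N then dexp k pi i.+1 else 0%N.
Proof.
rewrite mnmDE !mnm_sumE [X in (X + _)%N]big1 ?add0n => [|l _]; last first.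
  by rewrite mulmnE mnm1E eq_lrshift.
rewrite big_mkcond (bigD1 i) //= big1 => [|l nel].
  by rewrite addn0 mulmnE mnm1E eqxx mul1n.
by rewrite mulmnE mnm1E eq_rshift (inj_eq perm_inj) (negbTE nel) if_same.
Qed.

Lemma Hclass_eq0 f : f \in @Jmu n k -> Hclass k f = 0.
Proof. by move=> Jf; rewrite -[RHS](raddf0 (Hclass k)); apply/lclassP; rewrite subr0. Qed.

Lemma Hclass_sum (I : finType) (P : pred I) (F : I -> {mpoly rat[n + n]}) :
  Hclass k (\sum_(i | P i) F i) = \sum_(i | P i) Hclass k (F i).
Proof. exact: (raddf_sum (Hclass k)). Qed.

(** The exponent of the term of [S] in the product of an elementary symmetric
    function with the monomial [m] divided by the variables of [T]. *)
Definition exchange (v : 'I_n -> 'I_(n + n)) (T S : {set 'I_n}) (m : mnm) : mnm :=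
  (m - set_mnm v T + set_mnm v S)%MM.

Lemma Hclass_exchange v (T : {set 'I_n}) m :
  v = x_ \/ v = y_ -> T != set0 -> (set_mnm v T <= m)%MM ->
  Hclass k 'X_[m] =
  - \sum_(S : {set 'I_n} | (#|S| == #|T|) && (S != T)) Hclass k 'X_[exchange v T S m].
Proof.
move=> vxy T0 leT; have T_gt0 : (0 < #|T|)%N by rewrite card_gt0.
have := Hclass_eq0 (@Jmu_elementary v (m - set_mnm v T)%MM #|T| vxy T_gt0).
rewrite Hclass_sum (bigD1 T) //= submK // => /eqP.
by rewrite addr_eq0 => /eqP.
Qed.

Definition side (v : 'I_n -> 'I_(n + n)) (e : int) : Prop :=
  (v = x_ /\ e = 1) \/ (v = y_ /\ e = -1).

Definition unmixed (m : mnm) : Prop :=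
  forall i, m (x_ i) = 0%N \/ m (y_ i) = 0%N.

(** Majorization is used here rather than dominance of bipartitions because a
    monomial in too many variables has no exponent bipartition. *)
Definition lower_span (m : mnm) : {pred Hquot n k} :=
  lspan (fun u => exists pi : 'S_n,
    mnm_majorized (descent_mnm pi) m /\ u = Hclass k (descent_mon k pi)).

Lemma lower_span_mono m1 m2 u :
  mnm_majorized m1 m2 -> u \in lower_span m1 -> u \in lower_span m2.
Proof.
move=> m12 /lspanP[p [c [h [Sh ->]]]]; apply/lspanP; exists p, c, h; split=> // i.
by have [pi [lepi hE]] := Sh i; exists pi; split=> //; apply: mnm_majorized_trans lepi m12.
Qed.

(** One straightening step, for x's and y's at once.  The
    monomials produced by [Hclass_exchange] have a smaller potential than [m],
    hence straighten by induction, and their exponents are majorized by those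
    of [m], so that the result lies in the span attached to [m]. *)
Lemma straighten_step v e (T : {set 'I_n}) m :
  side v e -> unmixed m -> T != set0 ->
  (forall j, j \in T -> 0 < e * zexp m j) ->
  (forall j l, j \in T -> l \notin T ->
     e * weight (zexp m) l + n%:Z < e * weight (zexp m) j) ->
  (forall m', potential (zexp m') < potential (zexp m) ->
     Hclass k 'X_[m'] \in lower_span m') ->
  Hclass k 'X_[m] \in lower_span m.
Proof.
move=> ve unm T0 Tpos gap IH.
have ee : e * e = 1 by case: ve => [] [_ ->].
have vE i : (m (v i))%:Z = Num.max (e * zexp m i) 0.
  by case: ve (unm i) => [] [-> ->] []; rewrite /zexp; lia.
have Tgt j l : j \in T -> l \notin T -> (m (v l) < m (v j))%N.
  move=> Tj nTl; rewrite -ltz_nat !vE; have := Tpos j Tj.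
  suff : e * zexp m l < e * zexp m j by lia.
  have := gap j l Tj nTl.
  by case: ve => [] [_ ->]; rewrite !(mul1r, mulN1r) => g; [|rewrite ltrN2]; 
     apply: (@weight_gap n); lia.
have Tm j : j \in T -> (0 < m (v j))%N.
  by move=> Tj; rewrite -ltz_nat vE; have := Tpos j Tj; lia.
have leT : (set_mnm v T <= m)%MM.
  apply/mnm_lepP => i; rewrite -(splitK i); move: Tm.
  by case: ve => [] [-> _] Tm; case: (split i) => j /=;
    rewrite ?set_mnm_x ?set_mnm_y ?set_mnm_xy ?set_mnm_yx //; case: (boolP (j \in T)) => // /Tm.
rewrite (Hclass_exchange _ T0 leT); last by case: ve => [] [->]; [left|right].
rewrite rpredN rpred_sum // => S /andP[/eqP cardS neS].
have mE : mnm_majorized (exchange v T S m) m /\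
   zexp (exchange v T S m) =1 (fun j => zexp m j - e * (j \in T)%:R + e * (j \in S)%:R).
  move: Tm Tgt {vE gap IH leT Tpos}.
  case: ve => [] [-> ->] Tm Tgt; split.
  - split; last by apply: majorized_eq => j; rewrite /= mnmDE mnmBE !set_mnm_xy subn0 addn0.
    apply: majorized_trans (majorized_transfer cardS Tm Tgt).
    by apply: majorized_eq => j; rewrite /= mnmDE mnmBE !set_mnm_x.
  - move=> j; rewrite /zexp !mnmDE !mnmBE !set_mnm_x !set_mnm_xy.
    by have := Tm j; case: (j \in T); case: (j \in S); lia.
  - split; first by apply: majorized_eq => j; rewrite /= mnmDE mnmBE !set_mnm_yx subn0 addn0.
    apply: majorized_trans (majorized_transfer cardS Tm Tgt).
    by apply: majorized_eq => j; rewrite /= mnmDE mnmBE !set_mnm_y.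
  - move=> j; rewrite /zexp !mnmDE !mnmBE !set_mnm_y !set_mnm_yx.
    by have := Tm j; case: (j \in T); case: (j \in S); lia.
have [maj zE] := mE.
apply: (lower_span_mono maj); apply: IH.
rewrite (_ : zexp _ = (fun j => zexp m j - e * (j \in T)%:R + e * (j \in S)%:R)).
  exact: potential_transfer.
exact/funext.
Qed.

Lemma Des_ord (pi : 'S_n) (p q : 'I_n) : q = p.+1 :> nat -> Des pi q = (pi q < pi p)%N.
Proof.
move=> qp; apply/existsP/idP => [[a /existsP[b /and3P[qa ba lt]]]|lt].
  have -> : p = a by apply: val_inj; move: qp (eqP qa) => /=; lia.
  by have -> : q = b by apply: val_inj; rewrite /= (eqP qa) (eqP ba).
by exists p; apply/existsP; exists q; rewrite lt qp eqxx.
Qed.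

(** Starting from the value 0 at position [k], the signed exponents count the
    descents between [k] and the current position: to its left they are the
    exponents of the x's, to its right the opposites of the exponents of the
    y's.  Positions [p] are counted from 0, so that position [k] is
    [p.+1 = k]. *)
Lemma descent_mnm_of_steps (pi : 'S_n) m : unmixed m ->
  (forall p : 'I_n, p.+1 = k -> zexp m (pi p) = 0) ->
  (forall p q : 'I_n, q = p.+1 :> nat ->
     zexp m (pi p) = zexp m (pi q) + (pi q < pi p)%N%:Z) ->
  m = descent_mnm pi.
Proof.
move=> unm z0 zstep.
have zx d : forall p : 'I_n, (p.+1 + d = k)%N ->
    zexp m (pi p) = (count (Des pi) (index_iota p.+1 k))%:Z.
  elim: d => [|d IH] p pd.
    by rewrite z0 /index_iota -?pd ?addn0 // subnn.
  have ltq : (p.+1 < n)%N by lia.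
  have idxE : index_iota p.+1 k = p.+1 :: index_iota p.+2 k.
    by rewrite /index_iota -[(k - p.+1)%N]subnSK //; lia.
  rewrite (zstep p (Ordinal ltq)) // IH /=; last lia.
  by rewrite -(@Des_ord pi p (Ordinal ltq) erefl) idxE /= PoszD addrC.
have zy d : forall p : 'I_n, (p.+1 = k + d)%N ->
    zexp m (pi p) = - (count (Des pi) (index_iota k p.+1))%:Z.
  elim: d => [|d IH] p pd.
    by rewrite z0 /index_iota ?pd ?addn0 // subnn.
  have ltq : (p.-1 < n)%N by have := ltn_ord p; lia.
  have pq : p = (Ordinal ltq).+1 :> nat by rewrite /=; lia.
  have := zstep _ _ pq; rewrite IH /=; last lia.
  rewrite -(Des_ord pi pq) /index_iota prednK; last lia.
  rewrite subSn; last lia.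
  by rewrite -addn1 iotaD count_cat /= subnKC; lia.
apply/mnmP=> i; rewrite -(splitK i); case: (split i) => j /=.
  rewrite -[j](permKV pi); set p := (pi^-1)%g j.
  rewrite descent_mnm_x /dexp; have [lt|ge] := ltnP p.+1 k.
    by have := zx (k - p.+1)%N p; case: (unm (pi p)); rewrite /zexp; lia.
  by have := zy (p.+1 - k)%N p; case: (unm (pi p)); rewrite /zexp; lia.
rewrite -[j](permKV pi); set p := (pi^-1)%g j.
rewrite descent_mnm_y /dexp; have [lt|ge] := ltnP k p.+1.
  by have := zy (p.+1 - k)%N p; case: (unm (pi p)); rewrite /zexp ltnNge ltnW //=; lia.
by have := zx (k - p.+1)%N p; case: (unm (pi p)); rewrite /zexp; lia.
Qed.

(** The straightening law; the induction is on the potential, shifted to be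
    nonnegative. *)
Lemma straighten m : Hclass k 'X_[m] \in lower_span m.
Proof.
have [N] := ubnP (absz (potential (zexp m) + n%:Z * n%:Z)).
elim: N m => // N IHN m; rewrite ltnS => leN.
have IH m' : potential (zexp m') < potential (zexp m) ->
    Hclass k 'X_[m'] \in lower_span m'.
  move=> lt; apply: IHN; apply: leq_trans leN.
  have := potential_ge (zexp m); have := potential_ge (zexp m'); lia.
have inJ : 'X_[m] \in @Jmu n k -> Hclass k 'X_[m] \in lower_span m.
  by move=> /Hclass_eq0 ->; apply: rpred0.
have [[i [mx my]]|mix] := pselect (exists i, 0 < m (x_ i) /\ 0 < m (y_ i))%N.
  exact: inJ (Jmu_mixed mx my).
have unm : unmixed m.
  move=> i; have [//|mx] := posnP (m (x_ i)); first by left.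
  by have [//|my] := posnP (m (y_ i)); [right | case: mix; exists i].
have [/Jmu_many_x/inJ //|few_x] := leqP k #|[pred i | 0 < m (x_ i)]|%N.
have [/Jmu_many_y/inJ //|few_y] := ltnP (n - k) #|[pred i | 0 < m (y_ i)]|%N.
have [pi sorted_pi] := exists_sorting_perm (@weight_inj n (zexp m)).
have le_w (p q : 'I_n) : (p <= q)%N -> weight (zexp m) (pi q) <= weight (zexp m) (pi p).
  by rewrite leq_eqVlt => /predU1P[/val_inj ->//|/sorted_pi/ltW].
have le_z (p q : 'I_n) : (p <= q)%N -> zexp m (pi q) <= zexp m (pi p).
  by move/le_w/weight_le.
(* A nonzero value at position [k] would force too many positive, or too many
   negative, values of the sorted function [zexp m]. *)
have z0 (p : 'I_n) : p.+1 = k -> zexp m (pi p) = 0.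
  move=> pk; have [neg|pos|//] := ltrgtP (zexp m (pi p)) 0.
    have := cardC [pred i | (0 < m (y_ i))%N]; rewrite card_ord.
    rewrite [X in (_ + X)%N](@eq_card _ _ [pred i | m (y_ i) == 0%N])
      => [|i]; last first.
      by rewrite !inE lt0n negbK.
    move=> tot; suff zle : (#|[pred i | m (y_ i) == 0%N]| <= p - 0)%N.
      by have := leq_add few_y zle; rewrite ?addSn tot; lia.
    apply: (card_pred_perm_le (s := (pi^-1)%g)) => i /= /eqP my0.
    rewrite ltnNge; apply/negP => /le_z; rewrite permKV.
    by move: neg; rewrite /zexp my0; lia.
  have := cardC [pred i | (0 < m (x_ i))%N]; rewrite card_ord.
  rewrite [X in (_ + X)%N](@eq_card _ _ [pred i | m (x_ i) == 0%N])
      => [|i]; last first.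
    by rewrite !inE lt0n negbK.
  move=> tot; suff zle : (#|[pred i | m (x_ i) == 0%N]| <= n - k)%N.
    by have := leq_add few_x zle; rewrite ?addSn tot; lia.
  apply: (card_pred_perm_le (s := (pi^-1)%g)) => i /= /eqP mx0.
  rewrite ltn_ord andbT -pk ltnNge; apply/negP => /le_z; rewrite permKV.
  by move: pos; rewrite /zexp mx0; lia.
(* A difference of weights above [n] means that [zexp m] drops by more than the 1
   of a descent, or the 0 of an ascent. *)
have [[p [q [qp gap]]]|nogap] := pselect (exists p q : 'I_n, q = p.+1 :> nat /\
    weight (zexp m) (pi q) + n%:Z < weight (zexp m) (pi p)).
  have gapT (a b : 'I_n) : (a <= p)%N -> (q <= b)%N ->
      weight (zexp m) (pi b) + n%:Z < weight (zexp m) (pi a).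
    by move=> /le_w ap /le_w bq; lia.
  have [ltk|gek] := ltnP p.+1 k.
    apply: (@straighten_step x_ 1 [set j | (pi^-1)%g j <= p]%N) => //; first by left.
    - by apply/set0Pn; exists (pi p); rewrite inE permK.
    - move=> j; rewrite inE mul1r -{2}[j](permKV pi) => le.
      have kp : (k.-1 < n)%N by lia.
      rewrite -(z0 (Ordinal kp)) ?prednK //.
      by apply/(@weight_gap n)/gapT => //=; lia.
    - move=> j l; rewrite !inE !mul1r -ltnNge => le lt.
      by rewrite -[j](permKV pi) -[l](permKV pi); apply: gapT; rewrite ?qp.
  apply: (@straighten_step y_ (-1) [set j | p < (pi^-1)%g j]%N) => //; first by right.
  - by apply/set0Pn; exists (pi q); rewrite inE permK qp.
  - move=> j; rewrite inE mulN1r oppr_gt0 -{2}[j](permKV pi) => lt.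
    have kp : (k.-1 < n)%N by lia.
    rewrite -(z0 (Ordinal kp)) ?prednK //.
    by apply/(@weight_gap n)/gapT => //=; lia.
  - move=> j l; rewrite !inE !mulN1r -leqNgt => lt le.
    have := gapT ((pi^-1)%g l) ((pi^-1)%g j) le; rewrite qp !permKV => /(_ lt); lia.
have mE : m = descent_mnm pi.
  apply: descent_mnm_of_steps => // p q qp.
  have := sorted_pi p q; rewrite qp ltnS leqnn => /(_ isT).
  have : ~ weight (zexp m) (pi q) + n%:Z < weight (zexp m) (pi p).
    by move=> gap; apply: nogap; exists p, q.
  rewrite /weight; have := ltn_ord (pi p); have := ltn_ord (pi q).
  have : pi p != pi q by rewrite (inj_eq perm_inj) -val_eqE /=; lia.
  rewrite -val_eqE /=.
  move: (zexp m (pi p)) (zexp m (pi q)) => a b.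
  move: (pi p : nat) (pi q : nat) => c d ne ltd ltc ngap sorted_ba.
  have [ltdc|ledc] := ltnP d c.
    suff : 0 < a - b < 2 by lia.
    by apply/andP; split; nia.
  suff : -1 < a - b < 1 by lia.
  by apply/andP; split; nia.
apply/lspanP; exists 1%N, (fun=> 1), (fun=> Hclass k 'X_[m]).
split; last by rewrite big_ord1 scale1r.
by move=> _; exists pi; rewrite descent_monE -mE; split.
Qed.

(** * Descent monomials and dominance *)

Lemma size_exp_bipartition (pi : 'S_n) :
  size (exp_bipartition k pi).1 = k /\ size (exp_bipartition k pi).2 = (n - k).+1.
Proof. by rewrite !size_rcons !size_map size_rev !size_iota subn1 subSS prednK. Qed.

Lemma sorted_exp_bipartition (pi : 'S_n) :
  sorted geq (exp_bipartition k pi).1 /\ sorted geq (exp_bipartition k pi).2.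
Proof.
split; apply: sorted_rcons0.
  apply: sorted_map_iota => i i1 ik; rewrite /dexp ik ifT /=; last lia.
  rewrite (_ : index_iota i k = i :: index_iota i.+1 k) ?leq_addl //.
  by rewrite /index_iota -[(k - i)%N]subnSK //; lia.
rewrite map_rev rev_sorted; apply: sorted_map_iota => i ki iltn.
rewrite /dexp !ifN; [|lia..].
rewrite /index_iota subSn; last lia.
by rewrite -addn1 iotaD count_cat /= leq_addr.
Qed.

Lemma sumn_exp_x (pi : 'S_n) (f : nat -> nat) : f 0%N = 0%N ->
  sumn (map f (exp_bipartition k pi).1) = (\sum_j f (descent_mnm pi (x_ j)))%N.
Proof.
move=> f0; rewrite map_rcons sumn_rcons f0 addn0 -map_comp sumnE big_map.
rewrite big_add1 big_mkord (big_ord_widen n (fun i => f (dexp k pi i.+1))) /=; last lia.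
rewrite [RHS](reindex_inj (@perm_inj _ pi)) big_mkcond; apply: eq_bigr => i _ /=.
by rewrite descent_mnm_x -ltnS prednK //; case: ifP.
Qed.

Lemma sumn_exp_y (pi : 'S_n) (f : nat -> nat) : f 0%N = 0%N ->
  sumn (map f (exp_bipartition k pi).2) = (\sum_j f (descent_mnm pi (y_ j)))%N.
Proof.
move=> f0; rewrite map_rcons sumn_rcons f0 addn0 -map_comp map_rev sumn_rev sumnE big_map.
rewrite big_add1 /= big_geq_mkord.
rewrite [RHS](reindex_inj (@perm_inj _ pi)) big_mkcond; apply: eq_bigr => i _ /=.
by rewrite descent_mnm_y ltnS; case: ifP.
Qed.

(** The two parts of the exponent bipartition are the sorted exponents of the
    descent monomial, up to zeros, which do not contribute to threshold sums. *)
Lemma bidom_of_majorized (pi1 pi2 : 'S_n) :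
  mnm_majorized (descent_mnm pi1) (descent_mnm pi2) ->
  bidom (exp_bipartition k pi1) (exp_bipartition k pi2).
Proof.
move=> [[xs xt] [ys yt]]; have [s1 s2] := sorted_exp_bipartition pi2.
split; apply: dominated_of_thresholds => //.
- by rewrite -[X in sumn X]map_id -[X in _ = sumn X]map_id !sumn_exp_x.
- by move=> v; rewrite !sumn_exp_x.
- by rewrite -[X in sumn X]map_id -[X in _ = sumn X]map_id !sumn_exp_y.
- by move=> v; rewrite !sumn_exp_y.
Qed.

(** Dominance is antisymmetric on sequences of equal lengths, and all exponent
    bipartitions have the same lengths. *)
Lemma bidom_strict_trans (pi1 pi2 : 'S_n) lam :
  bidom (exp_bipartition k pi1) (exp_bipartition k pi2) ->
  bidom_strict (exp_bipartition k pi2) lam ->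
  bidom_strict (exp_bipartition k pi1) lam.
Proof.
move=> le12 [le2 ne2]; split; first exact: bidom_trans le12 le2.
move=> eq1; apply: ne2; rewrite -eq1 in le2 *.
have [s1 s1'] := size_exp_bipartition pi1; have [s2 s2'] := size_exp_bipartition pi2.
by apply: bidom_antisym => //; rewrite ?s1 ?s1'.
Qed.

(** Permuting the variables turns a descent monomial into a monomial with the
    same multisets of exponents, to which the straightening law applies. *)
Lemma hact_descent (pi s : 'S_n) :
  hact n k (Hclass k (descent_mon k pi)) s \in lspan (fun u => exists pi' : 'S_n,
    bidom (exp_bipartition k pi') (exp_bipartition k pi) /\
    u = Hclass k (descent_mon k pi')).
Proof.
rewrite hactE descent_monE /pact msymX; set m := [multinom _ | _ < _].
have maj : mnm_majorized m (descent_mnm pi).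
  have permV t i : (diag_perm t)^-1%g (x_ i) = x_ (t^-1%g i) /\
                   (diag_perm t)^-1%g (y_ i) = y_ (t^-1%g i).
    by split; rewrite -{1}[i](permKV t) -?diag_perml -?diag_permr permK.
  split.
    rewrite (_ : m \o x_ = (descent_mnm pi \o x_) \o s^-1%g); first exact: majorized_perm.
    by apply/funext => i; rewrite /= mnmE (permV s i).1.
  rewrite (_ : m \o y_ = (descent_mnm pi \o y_) \o s^-1%g); first exact: majorized_perm.
  by apply/funext => i; rewrite /= mnmE (permV s i).2.
have /lspanP[p [c [h [Sh ->]]]] := straighten m.
apply/lspanP; exists p, c, h; split=> // i; have [pi' [maj' ->]] := Sh i.
exists pi'; split=> //; apply: bidom_of_majorized.
exact: mnm_majorized_trans maj' maj.
Qed.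

(** Straightening only moves down in dominance order, so closure of [P] under
    passing to dominated bipartitions is all that both spans need. *)
Lemma Sn_invariant_span (P : seq nat * seq nat -> Prop) :
  (forall pi pi' : 'S_n, bidom (exp_bipartition k pi') (exp_bipartition k pi) ->
     P (exp_bipartition k pi) -> P (exp_bipartition k pi')) ->
  Sn_invariant (lspan (fun u : Hquot n k => exists pi : 'S_n,
     P (exp_bipartition k pi) /\ u = Hclass k (descent_mon k pi))).
Proof.
move=> Pdown s u /lspanP[p [c [h [Sh ->]]]].
rewrite (linear_sum (@hact_is_linear n k s)).
apply: rpred_sum => i _; apply: rpredZ; have [pi [Ppi ->]] := Sh i.
apply: lspan_mono (hact_descent pi s) => v [pi' [le vE]].
by exists pi'; split=> //; apply: Pdown le Ppi.
Qed.

End HookShape.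

(** * The action on the quotient *)

Section QuotientAction.
Variables (n k : nat) (lam : seq nat * seq nat).
Hypotheses (le_inv : Sn_invariant (@I_le n k lam)) (lt_inv : Sn_invariant (@I_lt n k lam)).

Let U := lsub (@I_le n k lam).

Definition sub_act (u : U) (s : 'S_n) : U := LSub (le_inv s (lsub_valP u)).

Definition Ract (x : Rmod n k lam) (s : 'S_n) : Rmod n k lam := Rclass (sub_act (lrepr x) s).

Lemma hact_sub s (u v : Hquot n k) : hact n k (u - v) s = hact n k u s - hact n k v s.
Proof. by rewrite addrC -scaleN1r (hact_is_linear s) scaleN1r addrC. Qed.

(** Independence of the chosen representative is the invariance of [I_lt]. *)
Lemma RactE (u v : U) s : lsub_val v = hact n k (lsub_val u) s ->
  Ract (Rclass u) s = Rclass v.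
Proof.
move=> vE; apply/lclassP; rewrite unfold_in raddfB /= vE -(hact_sub s).
by apply: lt_inv; have /lclassP : Rclass (lrepr (Rclass u)) = Rclass u by exact: lreprK.
Qed.

Lemma Ract_Rclass (u : U) s : Ract (Rclass u) s = Rclass (sub_act u s).
Proof. exact: RactE. Qed.

Lemma Rclass_surj x : exists u : U, x = Rclass u.
Proof. by exists (lrepr x); rewrite /Rclass lreprK. Qed.

Lemma Ract_is_action : is_action [set: 'S_n] Ract.
Proof.
have actM x s t : Ract x (s * t)%g = Ract (Ract x s) t.
  have [u ->] := Rclass_surj x.
  rewrite !Ract_Rclass.
  congr Rclass; apply: val_inj; exact: (hact_is_action n k).2 _ _ _ (in_setT s) (in_setT t).
have act1 x : Ract x 1%g = x.
  by have [u ->] := Rclass_surj x; apply: RactE; rewrite /= -[lsub_val u]lreprK hact_funE pact1.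
split=> [s|x s t _ _]; last exact: actM.
by apply: (can_inj (g := Ract^~ s^-1%g)) => x; rewrite -actM mulgV act1.
Qed.

Lemma Ract_is_linear s : linear (Ract^~ s).
Proof.
move=> a x y; have [u ->] := Rclass_surj x; have [w ->] := Rclass_surj y.
have RclassL c (u1 u2 : U) : c *: Rclass u1 + Rclass u2 = Rclass (c *: u1 + u2).
  by rewrite /Rclass lclassD lclassZ.
rewrite RclassL !Ract_Rclass RclassL.
congr Rclass; apply: val_inj => /=.
exact: hact_is_linear.
Qed.

End QuotientAction.

Theorem proposition1p10 (n k : nat) (k_gt0 : (1 <= k)%N) (le_kn : (k <= n)%N)
    (lam : seq nat * seq nat) (lam_bip : is_bipartition n k lam) :
  [/\ Sn_invariant (@I_le n k lam),
      Sn_invariant (@I_lt n k lam)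
    & exists rho : {action 'S_n &-> @Rmod n k lam},
        (forall s : 'S_n, linear (rho^~ s)) /\
        (forall (s : 'S_n) (u v : lsub (@I_le n k lam)),
            lsub_val v = hact n k (lsub_val u) s ->
            rho (Rclass u) s = Rclass v)].
Proof.
have le_inv : Sn_invariant (@I_le n k lam).
  apply: (Sn_invariant_span k_gt0 le_kn (P := fun l => bidom l lam)) => pi pi'.
  exact: bidom_trans.
have lt_inv : Sn_invariant (@I_lt n k lam).
  apply: (Sn_invariant_span k_gt0 le_kn (P := fun l => bidom_strict l lam)) => pi pi'.
  exact: bidom_strict_trans.
split=> //; exists (Action (Ract_is_action le_inv lt_inv)); split=> [s|s u v vE].
  exact: Ract_is_linear.
exact: RactE.
Qed.
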